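(* Fix $0<\alpha<\frac12$, a level $j\in\{0,\dots,J-1\}$, and a Besov body $B_{p,q}^{\beta}(M)$. Let $CB(\delta,r_\alpha)=\{\theta_j:\|\theta_j-\delta\|_2\le r_\alpha\}$ be a confidence ball for $\theta_j=(\theta_{j,k})_{k=1}^{2^j}$ with data-dependent center $\delta$ and random (data-dependent) radius $r_\alpha$ which has guaranteed coverage probability over $B_{p,q}^\beta(M)$ of at least $1-\alpha$, i.e. $\inf_{\theta\in B_{p,q}^\beta(M)}P_\theta(\theta_j\in CB(\delta,r_\alpha))\ge 1-\alpha$. Then for any $0<\varepsilon<\frac12\left(\frac12-\alpha\right)$, $$\sup_{\theta\in B_{p,q}^\beta(M)}E_\theta(r_\alpha^2)\ \ge\ \frac{\varepsilon^2}{1-\alpha-\varepsilon}\min\left(M^2 2^{-2\beta j},\ z_{\alpha+2\varepsilon}^2\,2^j n^{-1}\right).$$ Moreover, for any $0<\varepsilon<\frac12-\alpha$, $$E_0(r_\alpha^2)\ \ge\ \tfrac14(1-2\alpha-2\varepsilon)\min\left(M^2 2^{-2\beta j},\ \log^{1/2}(1+\varepsilon^2)\,2^{j/2}n^{-1}\right),$$ where $E_0$ denotes expectation under $\theta=0$.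
   Context: Model: one observes $y_{j,k}=\theta_{j,k}+\frac{1}{\sqrt n}z_{j,k}$, $j=0,1,\dots,J-1$, $k=1,\dots,2^j$, with $z_{j,k}$ i.i.d. $N(0,1)$, where $2^J-1=N$ is the total number of coordinates, so $\theta=(\theta_{j,k})\in\mathbb{R}^N$. $P_\theta,E_\theta$ denote probability and expectation under $\theta$. For a level $j$, $\theta_j=\{\theta_{j,k}:k=1,\dots,2^j\}\in\mathbb{R}^{2^j}$. Besov body: for $\beta>0$, $p\ge2$, $q\ge1$, $M>0$ and $s=\beta+\frac12-\frac1p>0$, $$B_{p,q}^{\beta}(M)=\left\{\theta:\left(\sum_{j=0}^{J-1}\left(2^{js}\Big(\sum_{k=1}^{2^j}|\theta_{j,k}|^p\Big)^{1/p}\right)^q\right)^{1/q}\le M\right\}.$$ $z_\alpha=\Phi^{-1}(1-\alpha)$, where $\Phi$ is the standard normal cumulative distribution function. $\log^{1/2}(x)$ means $(\log x)^{1/2}$. *)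

(* Defs.v *)
From mathcomp Require Import all_boot all_order all_algebra.
From mathcomp Require Import all_classical all_reals all_analysis.

Set Implicit Arguments.
Unset Strict Implicit.
Unset Printing Implicit Defensive.

Import Order.TTheory GRing.Theory Num.Theory.
Import numFieldNormedType.Exports.

Local Open Scope classical_set_scope.
Local Open Scope ring_scope.

(* The pairs (j, k) with j < J and k < 2 ^ j, so there are 2 ^ J - 1 of them;
   k is numbered from 0 rather than from 1. *)
Definition besov_index (J : nat) := {j : 'I_J & 'I_(2 ^ j)}.

Definition level (R : realType) (J : nat) (j : 'I_J) (theta : besov_index J -> R) :
    'I_(2 ^ j) -> R :=
  fun k => theta (existT (fun j : 'I_J => 'I_(2 ^ j)) j k).

Arguments level {R J} j theta _.

(* The sample space R^N, with the product Borel sigma-algebra. *)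
Definition data (R : realType) (J : nat) :=
  g_sigma_algebraType (\bigcup_(i in [set: besov_index J])
    preimage_set_system [set: besov_index J -> R] (fun y => y i) measurable).

Definition besov_body (R : realType) (J : nat) (beta p q M : R) :
    set (besov_index J -> R) :=
  let s := beta + 1 / 2 - 1 / p in
  [set theta : besov_index J -> R |
    (\sum_(j < J)
       (2 `^ (j%:R * s) *
        (\sum_(k < 2 ^ j) `|level j theta k| `^ p) `^ (1 / p)) `^ q)
    `^ (1 / q) <= M].

Definition mutually_independent d (T : measurableType d) (R : realType)
    (P : probability T R) (I : finType) (X : I -> T -> R) :=
  forall (A : {set I}) (B : I -> set R), (forall i, measurable (B i)) ->
    P (\bigcap_(i in [set` A]) X i @^-1` B i) =
    (\prod_(i in A) P (X i @^-1` B i))%E.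

Definition iid_std_normal d (T : measurableType d) (R : realType)
    (P : probability T R) (I : finType) (X : I -> {RV P >-> R}) :=
  (forall i (B : set R), measurable B ->
     distribution P (X i) B = normal_prob 0 1 B) /\
  mutually_independent P (fun i => X i : T -> R).

Section model.
Context d (T : measurableType d) (R : realType) (P : probability T R).
Context (J n : nat) (z : besov_index J -> {RV P >-> R}).

(* y_{j,k} = theta_{j,k} + n^{-1/2} z_{j,k}; the law P_theta of the data is the
   image of P under this map. *)
Definition observation (theta : besov_index J -> R) : T -> data R J :=
  fun w i => theta i + 1 / Num.sqrt n%:R * z i w.

Definition Pr_ (theta : besov_index J -> R) (A : set (data R J)) : \bar R :=
  pushforward P (observation theta) A.

Definition Ex_ (theta : besov_index J -> R) (f : data R J -> R) : \bar R :=
  'E_P[f \o observation theta]%E.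

End model.

Definition l2norm (R : realType) (m : nat) (x : 'I_m -> R) : R :=
  Num.sqrt (\sum_k x k ^+ 2).

Definition conf_ball (R : realType) (m : nat) (delta : 'I_m -> R) (r : R) :
    set ('I_m -> R) :=
  [set t | l2norm (t \- delta) <= r].

(* The second parameter of normal_prob is the standard deviation. *)
Definition Phi (R : realType) (x : R) : R :=
  fine (normal_prob 0 1 `]-oo, x]).

(* The inverse function of Phi; its default value 0 is only taken outside the
   range of Phi. *)
Definition z_quantile (R : realType) (alpha : R) : R :=
  'pinv_(fun=> 0) [set: R] (@Phi R) (1 - alpha).

(* Main.v *)
Require Import Defs.
From HB Require Import structures.
From mathcomp Require Import all_boot all_order all_algebra.
From mathcomp Require Import all_classical all_reals all_analysis.
From mathcomp Require Import measurable_realfun.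
From mathcomp Require Import ring lra.

Set Implicit Arguments.
Unset Strict Implicit.
Unset Printing Implicit Defensive.

Import Order.TTheory GRing.Theory Num.Theory.
Import numFieldNormedType.Exports.

Local Open Scope classical_set_scope.
Local Open Scope ring_scope.

(** Both bounds come from one finite prior on the Besov body: all parameters that
vanish outside level [j] and whose [m = 2 ^ j] entries there are [+ a] or [- a],
with independent fair signs.  Such a parameter has Besov norm
[2 ^ (j (beta + 1/2)) a] and satisfies [m a ^ 2 = ||theta_j|| ^ 2], so every value
[b <= M ^ 2 2 ^ (- 2 beta j)] of [m a ^ 2] is available ([besov_body_signs]).

First bound.  Take [sqrt n a <= z_(alpha + 2 eps)].  For each coordinate, flipping
one sign leaves a test between [N(a, 1/n)] and [N(- a, 1/n)]; by the
Neyman-Pearson lemma the two error probabilities of the test given by the sign of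
[delta_k] add up to at least twice the Gaussian tail beyond [sqrt n a], hence to
at least [2 (alpha + 2 eps)] ([neyman_pearson], [sign_error_ge]).  A wrong sign of
[delta_k] costs at least [a ^ 2] in [||theta_j - delta|| ^ 2], which is at most
[r ^ 2] whenever the ball covers, and the ball misses with probability at most
[alpha].  Averaging over the prior, some [theta] has
[E r ^ 2 >= m a ^ 2 ((alpha + 2 eps) - alpha)] ([sign_error_lower_bound]), and
[2 eps >= eps ^ 2 / (1 - alpha - eps)].

Second bound.  Let [n ^ 2 m a ^ 4 <= ln (1 + eps ^ 2)].  The chi-square divergence
of the prior mixture from [P_0] is [cosh (n a ^ 2) ^ m - 1 <= (2 eps) ^ 2], so the
mixture gives no event a probability exceeding that under [P_0] by more than
[2 eps] ([sum_pr_signs_le]).  Under the mixture the ball contains one of the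
points [(+- a, ..., +- a)] with probability at least [1 - alpha]; therefore under
[P_0] it contains with probability at least [1 - 2 alpha - 2 eps] both [0] and such
a point, and then [(2 r) ^ 2 >= m a ^ 2] ([chi2_lower_bound]).

Everything about [P_theta] that enters is the Cameron-Martin formula [Pr_lr]: the
law of the data under [theta] has an explicit density with respect to the law
under [0].  It is checked on rectangles, where independence reduces it to the
Gaussian shift identity [ge0_integral_gauss_shift] in each coordinate. *)

(** * Measures given by a density *)

Section density.
Context d (T : measurableType d) (R : realType).
Variable mu : {measure set T -> \bar R}.

(** The two proofs are arguments so that the measure structure can be inferred. *)
Definition mdensity (h : T -> R) (h0 : forall x, 0 <= h x)
    (mh : measurable_fun [set: T] h) (A : set T) : \bar R :=
  (\int[mu]_(x in A) (h x)%:E)%E.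

Variables (h : T -> R) (h0 : forall x, 0 <= h x)
  (mh : measurable_fun [set: T] h).

Let mdensity0 : mdensity h0 mh set0 = 0%E.
Proof. by rewrite /mdensity integral_set0. Qed.

Let mdensity_ge0 A : (0 <= mdensity h0 mh A)%E.
Proof. by apply: integral_ge0 => x _; rewrite lee_fin. Qed.

Let mdensity_sigma_additive : semi_sigma_additive (mdensity h0 mh).
Proof.
move=> /= A mA tA mUA; rewrite /mdensity ge0_integral_bigcup//=.
- apply: is_cvg_ereal_nneg_natsum_cond => n _ _; exact: mdensity_ge0.
- by apply/measurable_EFinP; exact: measurable_funTS.
- by move=> x _; rewrite lee_fin.
Qed.

HB.instance Definition _ := isMeasure.Build _ _ _
  (mdensity h0 mh) mdensity0 mdensity_ge0 mdensity_sigma_additive.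

Import HBNNSimple.

(** The density [h] is finite, so that multiplying by [h x] commutes with the
increasing limit of the simple functions that approximate [f]. *)
Lemma ge0_integral_density (nu : {measure set T -> \bar R}) :
  (forall A, measurable A -> nu A = (\int[mu]_(x in A) (h x)%:E)%E) ->
  forall f : T -> \bar R, (forall x, 0 <= f x)%E -> measurable_fun [set: T] f ->
  (\int[nu]_x f x = \int[mu]_x (f x * (h x)%:E))%E.
Proof.
move=> nuE f f0 mf.
have mEh : measurable_fun [set: T] (EFin \o h) by exact/measurable_EFinP.
pose u := nnsfun_approx measurableT mf.
have uf x : (u n x)%:E @[n --> \oo] --> f x by exact: cvg_nnsfun_approx.
have -> : (\int[nu]_x f x = limn (fun n => \int[nu]_x (u n x)%:E))%E.
  rewrite -monotone_convergence//.
  - by apply: eq_integral => x _; apply/esym/cvg_lim => //; exact: uf.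
  - by move=> n; apply/measurable_EFinP; exact/measurable_funP.
  - by move=> n x _; rewrite lee_fin.
  - by move=> x _ a b ab; rewrite lee_fin; exact/lefP/nd_nnsfun_approx.
have -> : (\int[mu]_x (f x * (h x)%:E) =
    limn (fun n => \int[mu]_x ((u n x)%:E * (h x)%:E)))%E.
  rewrite -monotone_convergence//.
  - apply: eq_integral => x _; apply/esym/cvg_lim => //.
    by apply: cvgeZr => //; exact: uf.
  - by move=> n; apply: emeasurable_funM => //; exact/measurable_EFinP.
  - by move=> n x _; rewrite mule_ge0// lee_fin.
  - move=> x _ a b ab; rewrite lee_wpmul2r ?lee_fin//.
    exact/lefP/nd_nnsfun_approx.
congr (limn _); apply/funext => n.
have mindic r : measurable_fun [set: T]
    (fun x => (r * \1_(u n @^-1` [set r]) x)%:E).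
  by apply/measurable_EFinP; exact: measurable_funM.
transitivity (\int[nu]_x
   (\sum_(y \in range (u n)) (y * \1_(u n @^-1` [set y]) x)%:E))%E.
  by apply: eq_integral => t _; rewrite /= fimfunE -fsumEFin.
rewrite ge0_integral_fsum//; last by move=> m y _; exact: nnfun_muleindic_ge0.
transitivity (\int[mu]_x (\sum_(y \in range (u n))
    (y * \1_(u n @^-1` [set y]) x)%:E * (h x)%:E))%E; last first.
  apply: eq_integral => x _.
  rewrite -ge0_mule_fsuml => [|y]; last exact: nnfun_muleindic_ge0.
  by rewrite fsumEFin // -(fimfunE _ x).
rewrite ge0_integral_fsum//; last 2 first.
  - by move=> y; apply: emeasurable_funM.
  - move=> m y _; apply: mule_ge0; first exact: nnfun_muleindic_ge0.
    by rewrite lee_fin.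
apply: eq_fsbigr => r /[!inE] -[t _ rt].
have r0 : 0 <= r by rewrite -rt.
under eq_integral do rewrite EFinM.
rewrite integralZl_indic_nnsfun// integral_indic// setIT nuE//.
under [RHS]eq_integral do rewrite EFinM -muleA.
rewrite ge0_integralZl//; last 2 first.
- by apply: emeasurable_funM => //; exact/measurable_EFinP.
- by move=> x _; rewrite mule_ge0 ?lee_fin.
congr (_ * _)%E; rewrite integral_mkcond; apply: eq_integral => x _.
by rewrite patchE indicE; case: ifPn => _; rewrite ?mul1e ?mul0e.
Qed.

End density.

(** * Products of functions of independent variables *)

Lemma indic_bigcap (R : comPzRingType) (K : finType) T (A : K -> set T) w :
  \1_(\bigcap_(i in [set: K]) A i) w = \prod_i \1_(A i) w :> R.
Proof.
have [Aw|nAw] := pselect (forall i, A i w).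
  rewrite indicE mem_set; last by move=> i _; exact: Aw.
  by rewrite big1// => i _; rewrite indicE mem_set.
have [i nAi] : exists i, ~ A i w by apply/existsNP.
rewrite indicE memNset; last by move=> /(_ i I).
by rewrite (bigD1 i)//= indicE memNset// mul0r.
Qed.

Section independence.
Context d (T : measurableType d) (R : realType) (P : probability T R).
Context (I : finType) (X : I -> {RV P >-> R}).
Hypothesis indep : mutually_independent P (fun i => X i : T -> R).

(** Independence is the case where all [f i] are indicators.  The indicators are
replaced by the [f i] one index at a time: for fixed other factors, both sides are
measures in the set whose indicator stands at index [i], so that their equality
passes to integrals of nonnegative functions. *)
Lemma expectation_prod_independent (f : I -> R -> R) (c : I -> R) :
  (forall i x, 0 <= f i x) -> (forall i, measurable_fun [set: R] (f i)) ->
  (forall i, \int[P]_w (f i (X i w))%:E = (c i)%:E)%E ->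
  (\int[P]_w (\prod_i f i (X i w))%:E = (\prod_i c i)%:E)%E.
Proof.
(* [s] lists the indices where [f i] need not be an indicator. *)
suff main (s : seq I) : forall (f : I -> R -> R) (c : I -> R),
    (forall i x, 0 <= f i x) -> (forall i, measurable_fun [set: R] (f i)) ->
    (forall i, \int[P]_w (f i (X i w))%:E = (c i)%:E)%E ->
    (forall i, i \notin s -> exists2 B, measurable B & f i = \1_B) ->
    (\int[P]_w (\prod_i f i (X i w))%:E = (\prod_i c i)%:E)%E.
  move=> f0 mf fc; apply: (main (enum I)) => // i.
  by rewrite mem_enum.
have mX i B : measurable B -> measurable (X i @^-1` B).
  by move=> mB; rewrite -[X in measurable X]setTI; exact: measurable_funP.
elim: s => [|i s IHs] {}f {}c f0 mf fc findic.
  have /choice[B BP] : forall i, exists B, measurable B /\ f i = \1_B.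
    by move=> i; have [B mB fB] := findic i isT; exists B.
  have mB i : measurable (B i) by case: (BP i).
  have fE i : f i = \1_(B i) by case: (BP i).
  have cE i : (c i)%:E = P (X i @^-1` B i).
    rewrite -fc fE -[X i @^-1` _]setIT -integral_indic//; exact: mX.
  rewrite -prodEFin (eq_bigr _ (fun i _ => cE i)).
  have -> : (\prod_i P (X i @^-1` B i) =
             \prod_(i in [set: I]%SET) P (X i @^-1` B i))%E.
    by apply: eq_bigl => i; rewrite inE.
  rewrite -indep// -[X in P X]setIT -integral_indic//; last first.
    by apply: fin_bigcap_measurable => // i _; exact: mX.
  apply: eq_integral => w _; rewrite (_ : [set` _] = setT) ?indic_bigcap.
    by congr EFin; apply: eq_bigr => j _; rewrite fE.
  by apply/seteqP; split => // j _; rewrite /= inE.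
(* [H] is the product of the other factors and [nu] the measure with density [H];
   by induction the image of [nu] under [X i] is [C] times the law of [X i]. *)
pose H w := \prod_(j | j != i) f j (X j w).
pose C := \prod_(j | j != i) c j.
have H0 w : 0 <= H w by apply: prodr_ge0.
have mH : measurable_fun [set: T] H.
  rewrite /H; under eq_fun do rewrite -big_filter.
  by apply: measurable_prod => j _; exact: measurableT_comp.
have c0 j : 0 <= c j.
  by rewrite -lee_fin -fc; apply: integral_ge0 => w _; rewrite lee_fin.
have C0 : 0 <= C by exact: prodr_ge0.
pose nu : {measure set T -> \bar R} := mdensity P H0 mH.
have mXi : measurable_fun [set: T] (X i) by [].
have nuE B : measurable B ->
    pushforward nu (X i) B = (\int[distribution P (X i)]_(x in B) (cst C x)%:E)%E.
  move=> mB; transitivity (C%:E * distribution P (X i) B)%E; last first.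
    by rewrite -integral_cst.
  rewrite [LHS]/(mdensity _ _ _ _) /mdensity.
  pose f' j := if j == i then \1_B else f j.
  pose c' j := if j == i then fine (distribution P (X i) B) else c j.
  have cE : (\prod_j c' j)%:E = (C%:E * distribution P (X i) B)%E.
    rewrite (bigD1 i)//= /c' eqxx mulrC EFinM fineK ?fin_num_measure//.
    by congr (_%:E * _)%E; apply: eq_bigr => j /negbTE ->.
  rewrite -cE -(IHs f' c').
  - rewrite integral_mkcond; apply: eq_integral => w _.
    rewrite patchE [in RHS](bigD1 i)//= /f' eqxx indicE.
    have -> : \prod_(j | j != i) (if j == i then \1_B else f j) (X j w) = H w.
      by apply: eq_bigr => j /negbTE ->.
    rewrite (_ : (w \in _) = (X i w \in B)); last by apply/idP/idP; rewrite !inE.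
    by case: ifPn; rewrite (mul1r, mul0r).
  - by move=> j x; rewrite /f'; case: ifP.
  - by move=> j; rewrite /f'; case: ifP.
  - move=> j; rewrite /f' /c'; case: eqVneq => [->|_]//.
    rewrite fineK ?fin_num_measure// -[LHS]/(\int[P]_w (\1_(X i @^-1` B) w)%:E)%E.
    rewrite integral_indic ?setIT//; exact: mX.
  - move=> j js; rewrite /f'; case: eqVneq => [_|ji]; first by exists B.
    by apply: findic; rewrite inE negb_or ji.
have mfi : measurable_fun [set: R] (fun x => (f i x)%:E) by exact/measurable_EFinP.
have fi0 x : (0 <= (f i x)%:E)%E by rewrite lee_fin.
have fXi0 w : (0 <= (f i (X i w))%:E)%E by rewrite lee_fin.
have mfXi : measurable_fun [set: T] (fun w => (f i (X i w))%:E).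
  by apply: measurableT_comp mfi mXi.
transitivity (\int[nu]_w (f i (X i w))%:E)%E.
  rewrite (@ge0_integral_density _ _ _ P H H0 mH nu)//.
  by apply: eq_integral => w _; rewrite (bigD1 i).
rewrite -(ge0_integral_pushforward mXi nu measurableT mfi)//.
rewrite (ge0_integral_density (fun=> C0) (measurable_cst C) nuE)//.
rewrite ge0_integral_distribution//; last 2 first.
- by apply: emeasurable_funM => //; exact: measurable_cst.
- by move=> x; rewrite mule_ge0// lee_fin.
by rewrite /= ge0_integralZr// fc (bigD1 i)// EFinM.
Qed.

End independence.

(** * Invariances of Lebesgue and Gaussian measure *)

Section gauss.
Context (R : realType).
Local Notation mu := (@lebesgue_measure R).
Local Notation gauss := (@normal_prob R 0 1).

(** Lebesgue measure is determined by its values on half-open intervals. *)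
Lemma ge0_integral_lebesgue_comp (g : R -> R) (f : R -> \bar R) :
  measurable_fun [set: R] g ->
  (forall a b, mu (g @^-1` `]a, b]%classic) = mu `]a, b]%classic) ->
  (forall x, 0 <= f x)%E -> measurable_fun [set: R] f ->
  (\int[mu]_x f (g x) = \int[mu]_x f x)%E.
Proof.
move=> mg gab f0 mf.
rewrite -(@ge0_integral_pushforward _ _ (measurableTypeR R) (measurableTypeR R) R
  g mg mu setT f)//.
apply: eq_measure_integral => A mA _.
by apply/esym/lebesgue_measure_unique => // X [[a b] _ <-]; apply/esym/gab.
Qed.

Lemma ge0_integral_lebesgue_shift (t : R) (f : R -> \bar R) :
  (forall x, 0 <= f x)%E -> measurable_fun [set: R] f ->
  (\int[mu]_x f (x + t)%R = \int[mu]_x f x)%E.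
Proof.
move=> f0 mf; apply: (ge0_integral_lebesgue_comp (g := fun x => x + t)) => //.
  exact: measurable_funD.
move=> a b; have -> : (fun x => x + t) @^-1` `]a, b]%classic = `]a - t, b - t]%classic.
  apply/seteqP; split=> x /=; rewrite !in_itv/= => /andP[? ?]; apply/andP; lra.
rewrite !lebesgue_measure_itv/= !lte_fin ltrD2r.
by case: ifP => // _; rewrite -!EFinD; congr EFin; ring.
Qed.

Lemma ge0_integral_lebesgue_opp (f : R -> \bar R) :
  (forall x, 0 <= f x)%E -> measurable_fun [set: R] f ->
  (\int[mu]_x f (- x)%R = \int[mu]_x f x)%E.
Proof.
move=> f0 mf; apply: (ge0_integral_lebesgue_comp (g := fun x => - x)) => //.
  exact: measurable_funN.
move=> a b; have -> : (fun x => - x) @^-1` `]a, b]%classic = `[- b, - a[%classic.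
  apply/seteqP; split=> x /=; rewrite !in_itv/= => /andP[? ?]; apply/andP; lra.
rewrite !lebesgue_measure_itv/= !lte_fin ltrN2.
by case: ifP => // _; rewrite -!EFinD; congr EFin; ring.
Qed.

Lemma ge0_integral_gauss (f : R -> \bar R) :
  (forall x, 0 <= f x)%E -> measurable_fun [set: R] f ->
  (\int[gauss]_x f x = \int[mu]_x (f x * (normal_pdf 0 1 x)%:E))%E.
Proof.
move=> f0 mf; apply: (@ge0_integral_density _ (measurableTypeR R) R mu (normal_pdf 0 1)) => //.
  exact: normal_pdf_ge0.
exact: measurable_normal_pdf.
Qed.

Lemma ge0_integral_gauss_opp (f : R -> \bar R) :
  (forall x, 0 <= f x)%E -> measurable_fun [set: R] f ->
  (\int[gauss]_x f (- x)%R = \int[gauss]_x f x)%E.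
Proof.
move=> f0 mf.
have mpdf : measurable_fun [set: R] (fun x : R => (normal_pdf 0 1 x)%:E).
  by apply/measurable_EFinP; exact: measurable_normal_pdf.
rewrite !ge0_integral_gauss//; last exact: measurableT_comp.
rewrite -[RHS]ge0_integral_lebesgue_opp; last 2 first.
- by move=> x; rewrite mule_ge0// lee_fin normal_pdf_ge0.
- exact: emeasurable_funM.
apply: eq_integral => x _; congr (_ * _%:E)%E.
by rewrite normal_pdfE ?oner_neq0//= /normal_fun !subr0 sqrrN.
Qed.

(** The exponential is the ratio of the densities of [N(t, 1)] and [N(0, 1)]. *)
Lemma ge0_integral_gauss_shift (t : R) (f : R -> \bar R) :
  (forall x, 0 <= f x)%E -> measurable_fun [set: R] f ->
  (\int[gauss]_x (f x * (expR (t * x - t ^+ 2 / 2))%:E) =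
   \int[gauss]_x f (x + t)%R)%E.
Proof.
move=> f0 mf.
have mpdf : measurable_fun [set: R] (fun x : R => (normal_pdf 0 1 x)%:E).
  by apply/measurable_EFinP; exact: measurable_normal_pdf.
have mexp : measurable_fun [set: R] (fun x : R => (expR (t * x - t ^+ 2 / 2))%:E).
  apply/measurable_EFinP; apply: measurableT_comp => //.
  by apply: measurable_funB => //; exact: measurable_funM.
have mft : measurable_fun [set: R] (fun x => f (x + t)).
  by apply: measurableT_comp => //; exact: measurable_funD.
rewrite !ge0_integral_gauss//; last 2 first.
- by move=> x; rewrite mule_ge0// lee_fin expR_ge0.
- exact: emeasurable_funM.
rewrite -[LHS](ge0_integral_lebesgue_shift t); last 2 first.
- by move=> x; rewrite !mule_ge0// lee_fin ?normal_pdf_ge0 ?expR_ge0.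
- by apply: emeasurable_funM => //; exact: emeasurable_funM.
apply: eq_integral => x _; rewrite -muleA -EFinM; congr (_ * _%:E)%E.
rewrite normal_pdfE ?oner_neq0//= /normal_fun !subr0 mulrCA -expRD.
congr (_ * expR _).
by field.
Qed.

End gauss.

(** * The Cameron-Martin formula for the sequence model *)

Section likelihood_ratio.
Context d (T : measurableType d) (R : realType) (P : probability T R).
Context (J n : nat) (z : besov_index J -> {RV P >-> R}).
Hypotheses (hn : (0 < n)%N) (hz : iid_std_normal z).
Implicit Types theta : besov_index J -> R.

Local Notation obs := (observation n z).

(** A family closed under intersection that generates the sigma-algebra of the data,
so that finite measures on the data are determined by their values on it. *)
Definition rectangles : set (set (data R J)) :=
  [set \bigcap_(i in [set: besov_index J]) ((fun y : data R J => y i) @^-1` B i) |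
    B in [set B : besov_index J -> set R | forall i, measurable (B i)]].

Lemma coordinate_measurable i (B : set R) : measurable B ->
  measurable ((fun y : data R J => y i) @^-1` B).
Proof.
move=> mB; apply: sub_sigma_algebra; exists i => //; exists B => //.
by rewrite setTI.
Qed.

Lemma rectangle_measurable : rectangles `<=` (@measurable _ (data R J)).
Proof.
move=> _ [B mB <-]; apply: fin_bigcap_measurable; first exact: finite_finset.
by move=> i _; exact: coordinate_measurable.
Qed.

Lemma rectangles_generate : (@measurable _ (data R J)) = <<s rectangles >>.
Proof.
apply/seteqP; split; last first.
  apply: smallest_sub; last exact: rectangle_measurable.
  exact: sigma_algebra_measurable.
apply: smallest_sub; first exact: smallest_sigma_algebra.
move=> _ [i _ [B mB <-]]; apply: sub_sigma_algebra.
exists (fun j => if j == i then B else setT).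
  by move=> j; case: ifP.
apply/seteqP; split => [y yB|y [_ yB] j _]; last by case: eqP => // ->.
by split => //; have := yB i I; rewrite eqxx.
Qed.

Lemma observation_measurable theta : measurable_fun [set: T] (obs theta).
Proof.
apply: (@measurability _ _ _ _ _ _ rectangles); first exact: rectangles_generate.
move=> _ [_ [B mB <-] <-]; rewrite setTI preimage_bigcap.
apply: fin_bigcap_measurable; first exact: finite_finset.
move=> i _; rewrite -[X in measurable X]setTI.
suff: measurable_fun [set: T] (fun w => theta i + 1 / Num.sqrt n%:R * z i w).
  by apply.
by apply: measurable_funD => //; exact: measurable_funM.
Qed.

(** The likelihood ratio of [P_theta] with respect to [P_0], as a function of the
noise: under [P_0] the noise at [i] is [Num.sqrt n] times the observation. *)
Definition lr theta (w : T) : R :=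
  \prod_i expR (Num.sqrt n%:R * theta i * z i w - (Num.sqrt n%:R * theta i) ^+ 2 / 2).

Lemma lr_ge0 theta w : 0 <= lr theta w.
Proof. by apply: prodr_ge0 => i _; exact: expR_ge0. Qed.

Lemma lr_measurable theta : measurable_fun [set: T] (lr theta).
Proof.
apply: measurable_prod => i _; apply: measurableT_comp => //.
by apply: measurable_funB => //; exact: measurable_funM.
Qed.

Lemma ge0_integral_z i (f : R -> \bar R) :
  (forall x, 0 <= f x)%E -> measurable_fun [set: R] f ->
  (\int[P]_w f (z i w) = \int[normal_prob 0 1]_x f x)%E.
Proof.
(* [z i] is seen with values in [measurableTypeR R], the type on which
   [normal_prob] is a measure. *)
move=> f0 mf.
have mzi : measurable_fun [set: T] (z i : T -> measurableTypeR R).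
  exact: (measurable_funP (z i)).
rewrite -(@ge0_integral_pushforward _ _ T (measurableTypeR R) R _ mzi P setT f)//.
by apply: eq_measure_integral => B mB _; exact: (hz.1 i).
Qed.

(** Both sides are finite measures in [A].  On a rectangle they are products over
the coordinates, and each pair of factors agrees by the Gaussian shift by
[Num.sqrt n * theta i]. *)
Lemma Pr_lr theta (A : set (data R J)) : measurable A ->
  Pr_ n z theta A = (\int[P]_(w in obs (fun=> 0)%R @^-1` A) (lr theta w)%:E)%E.
Proof.
move=> mA.
pose nu : {measure set T -> \bar R} := mdensity P (lr_ge0 theta) (lr_measurable theta).
have n0 : 0 < Num.sqrt n%:R :> R by rewrite sqrtr_gt0 ltr0n.
have -> : (\int[P]_(w in obs (fun=> 0)%R @^-1` A) (lr theta w)%:E)%E =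
   pushforward nu (obs (fun=> 0)) A by [].
rewrite /Pr_.
apply: (@measure_unique _ R (data R J) rectangles (fun=> setT) _ _ _ _
  (pushforward P (obs theta)) (pushforward nu (obs (fun=> 0)))) => //.
- exact: rectangles_generate.
- move=> _ _ [B mB <-] [C mC <-]; exists (fun i => B i `&` C i).
    by move=> i; exact: measurableI.
  by rewrite -bigcapI.
- move=> k; exists (fun=> setT) => //.
  by apply/seteqP; split.
- exact: bigcup_const.
- exact: observation_measurable.
- exact: observation_measurable.
- move=> mobs mobs0 _ [B mB <-].
  pose u := Num.sqrt n%:R : R.
  pose c i := fine (\int[normal_prob 0 1]_x (\1_(B i) (theta i + 1 / u * x) : R)%:E)%E.
  have mBi i (t : R) : measurable_fun [set: R] (fun x => \1_(B i) (t + 1 / u * x) : R).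
    have mi : measurable_fun [set: R] (\1_(B i) : R -> R) by exact: measurable_indic.
    apply: (measurableT_comp mi).
    by apply: measurable_funD => //; exact: measurable_funM.
  have mEBi i (t : R) :
      measurable_fun [set: R] (fun x => (\1_(B i) (t + 1 / u * x) : R)%:E).
    by apply/measurable_EFinP; exact: mBi.
  (* [c i] is the probability of the [i]-th side of the rectangle under [theta]. *)
  have cE i : ((c i)%:E = \int[normal_prob 0 1]_x (\1_(B i) (theta i + 1 / u * x) : R)%:E)%E.
    rewrite fineK// ge0_fin_numE; last first.
      by apply: integral_ge0 => x _; rewrite lee_fin.
    apply: (@le_lt_trans _ _ (\int[normal_prob (0 : R) 1]_x (cst 1%E x))%E).
      apply: ge0_le_integral => //.
      - exact: mEBi.
      - by move=> x _; rewrite lee_fin indicE lern1 leq_b1.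
    by rewrite integral_cst//= mul1e (@probability_setT _ _ _ (normal_prob (0 : R) 1)) ltry.
  transitivity ((\prod_i c i)%:E : \bar R).
  + rewrite -(expectation_prod_independent hz.2
      (f := fun i x => \1_(B i) (theta i + 1 / u * x))) => // [|i]; last first.
      rewrite cE.
      apply: (ge0_integral_z i (f := fun x => (\1_(B i) (theta i + 1 / u * x))%:E)) => //.
    transitivity (\int[P]_w (\1_(obs theta @^-1`
        (\bigcap_i ((fun y : data R J => y i) @^-1` B i))) w)%:E)%E.
      rewrite integral_indic ?setIT//.
      rewrite -[X in measurable X]setTI; apply: observation_measurable => //.
      by apply: rectangle_measurable; exists B.
    by apply: eq_integral => w _; rewrite preimage_bigcap indic_bigcap.
  + rewrite -(expectation_prod_independent hz.2 (f := fun i x =>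
      \1_(B i) (0 + 1 / u * x) * expR (u * theta i * x - (u * theta i) ^+ 2 / 2))).
    * transitivity (\int[P]_(w in obs (fun=> 0)%R @^-1`
        (\bigcap_i ((fun y : data R J => y i) @^-1` B i))) (lr theta w)%:E)%E => //.
      rewrite [RHS]integral_mkcond; apply: eq_integral => w _; rewrite patchE big_split/= EFinM.
      rewrite (_ : \prod_i _ = \1_(obs (fun=> 0) @^-1`
          (\bigcap_i ((fun y : data R J => y i) @^-1` B i))) w :> R); last first.
        rewrite preimage_bigcap indic_bigcap; apply: eq_bigr => i _.
        by rewrite !indicE; congr (nat_of_bool _)%:R; rewrite [RHS]in_setE/=.
      by rewrite indicE; case: ifPn => _; rewrite ?mul1e ?mul0e.
    * by move=> i x; rewrite mulr_ge0 ?expR_ge0.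
    * move=> i; apply: measurable_funM; last first.
        apply: measurableT_comp => //.
        by apply: measurable_funB => //; exact: measurable_funM.
      exact: mBi.
    * move=> i; rewrite cE.
      rewrite (ge0_integral_z i (f := fun x => (\1_(B i) (0 + 1 / u * x) *
        expR (u * theta i * x - (u * theta i) ^+ 2 / 2))%:E)); last 2 first.
        by move=> x; rewrite lee_fin mulr_ge0 ?expR_ge0.
      - apply/measurable_EFinP; apply: measurable_funM; first exact: mBi.
        apply: measurableT_comp => //.
        by apply: measurable_funB => //; exact: measurable_funM.
      under eq_integral do rewrite EFinM.
      rewrite (ge0_integral_gauss_shift (u * theta i)
        (f := fun x => (\1_(B i) (0 + 1 / u * x))%:E))//.
      apply: eq_integral => x _; congr (\1_(B i) _)%:E.
      by rewrite /u; field; rewrite gt_eqF.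
- move=> mobs _.
  by rewrite /= /pushforward preimage_setT probability_setT ltry.
Qed.

End likelihood_ratio.

(** * Total variation and testing *)

Section total_variation.
Context d (T : measurableType d) (R : realType) (P : probability T R).

(** A chi-square divergence of at most [c ^ 2] bounds the total variation by [c]:
[L - 1 <= ((L - 1) ^ 2 / c + c) / 2], and the integral of [(L - 1) ^ 2] over the
whole space is the chi-square divergence. *)
Lemma integral_le_probability_add (L : T -> R) (c : R) (E : set T) :
  0 < c -> (forall w, 0 <= L w) -> measurable_fun [set: T] L -> measurable E ->
  (\int[P]_w (L w)%:E = 1)%E -> (\int[P]_w (L w ^+ 2)%:E <= (1 + c ^+ 2)%:E)%E ->
  (\int[P]_(w in E) (L w)%:E <= P E + c%:E)%E.
Proof.
move=> c0 L0 mL mE L1 L2.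
pose W w := (L w - 1) ^+ 2.
have W0 w : 0 <= W w by exact: sqr_ge0.
have mW : measurable_fun [set: T] W.
  by apply: measurable_funX; exact: measurable_funB.
have mW1 : measurable_fun [set: T] (fun w => (W w)%:E) by exact/measurable_EFinP.
have mL1 : measurable_fun [set: T] (fun w => (L w)%:E) by exact/measurable_EFinP.
have W_le : (\int[P]_w (W w)%:E <= (c ^+ 2)%:E)%E.
  have H : (\int[P]_w (W w)%:E + 2%:E = \int[P]_w (L w ^+ 2)%:E + 1)%E.
    have -> : (2%:E = \int[P]_w ((2 * L w)%:E) :> \bar R)%E.
      under eq_integral do rewrite EFinM.
      by rewrite ge0_integralZl// ?L1 ?mule1// => w _; rewrite lee_fin.
    have -> : (1 = \int[P]_w (cst 1 w) :> \bar R)%E.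
      by rewrite integral_cst// mul1e [RHS]probability_setT.
    have L20 w : (0 <= (L w ^+ 2)%:E)%E by rewrite lee_fin sqr_ge0.
    have mL2 : measurable_fun [set: T] (fun w => (L w ^+ 2)%:E).
      by apply/measurable_EFinP; exact: measurable_funX.
    have LL0 w : (0 <= (2 * L w)%:E)%E by rewrite lee_fin mulr_ge0.
    have mLL : measurable_fun [set: T] (fun w => (2 * L w)%:E).
      by apply/measurable_EFinP; exact: measurable_funM.
    have W0' w : (0 <= (W w)%:E)%E by rewrite lee_fin.
    rewrite -!ge0_integralD//.
    by apply: eq_integral => w _; rewrite /= -!EFinD; congr EFin; rewrite /W; ring.
  rewrite -(@leeD2rE _ 2%:E)// H; apply: le_trans (leeD2r 1%E L2) _.
  by rewrite -!EFinD lee_fin; lra.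
have cW0 w : (0 <= ((2 * c)^-1 * W w)%:E)%E.
  by rewrite lee_fin mulr_ge0// invr_ge0; lra.
have mcW D : measurable_fun D (fun w => ((2 * c)^-1 * W w)%:E).
  by apply: measurable_funTS; apply/measurable_EFinP; exact: measurable_funM.
have PE1 : (P E <= 1)%E by exact: probability_le1.
apply: (@le_trans _ _ (\int[P]_(w in E) (cst (1 + c / 2)%:E w + ((2 * c)^-1 * W w)%:E))%E).
  apply: ge0_le_integral => //.
  - by move=> w _; rewrite lee_fin.
  - exact: measurable_funTS.
  - by apply: emeasurable_funD.
  - move=> w _; rewrite /= -EFinD lee_fin.
    suff -> : 1 + c / 2 + (2 * c)^-1 * W w = L w + (2 * c)^-1 * (L w - 1 - c) ^+ 2.
      by rewrite lerDl mulr_ge0 ?sqr_ge0// invr_ge0; lra.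
    by rewrite /W; field; rewrite gt_eqF.
rewrite ge0_integralD//; last by move=> w _ /=; rewrite lee_fin; lra.
rewrite integral_cst//.
have -> : (P E + c%:E = P E + (c / 2)%:E * 1 + (c / 2)%:E :> \bar R)%E.
  by rewrite mule1 -addeA -EFinD; congr (_ + _%:E)%E; field.
rewrite EFinD ge0_muleDl ?lee_fin//; last by lra.
rewrite mul1e; apply: leeD; first by rewrite leeD2l// lee_pmul2l// lte_fin; lra.
apply: (@le_trans _ _ (\int[P]_w ((2 * c)^-1 * W w)%:E)%E).
  by apply: ge0_subset_integral.
under eq_integral do rewrite EFinM.
rewrite ge0_integralZl//; last 2 first.
- by move=> w _; rewrite lee_fin.
- by rewrite lee_fin invr_ge0; lra.
apply: (@le_trans _ _ (((2 * c)^-1)%:E * (c ^+ 2)%:E)%E).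
  by rewrite lee_pmul2l// lte_fin invr_gt0; lra.
by rewrite -EFinM lee_fin le_eqVlt; apply/orP; left; apply/eqP; field; rewrite gt_eqF.
Qed.

End total_variation.

Section likelihood_ratio_consequences.
Context d (T : measurableType d) (R : realType) (P : probability T R).
Context (J n : nat) (z : besov_index J -> {RV P >-> R}).
Hypotheses (hn : (0 < n)%N) (hz : iid_std_normal z).
Implicit Types theta : besov_index J -> R.

Local Notation obs := (observation n z).
Local Notation lr := (lr n z).

Lemma observation_preimage_measurable theta (A : set (data R J)) :
  measurable A -> measurable (obs theta @^-1` A).
Proof.
by move=> mA; rewrite -[X in measurable X]setTI; exact: observation_measurable.
Qed.

Lemma integral_lr theta : (\int[P]_w (lr theta w)%:E = 1)%E.
Proof.
have := Pr_lr hn hz theta measurableT.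
by rewrite /Pr_ /pushforward !preimage_setT probability_setT => <-.
Qed.

Lemma lrM theta theta' w : lr theta w * lr theta' w =
  expR (n%:R * \sum_i theta i * theta' i) * lr (theta \+ theta') w.
Proof.
rewrite mulr_sumr expR_sum /lr -!big_split/=; apply: eq_bigr => i _.
rewrite -!expRD; congr expR; rewrite -[X in X * (theta i * _)](@sqr_sqrtr R)//.
by field.
Qed.

(** The second moments behind the chi-square divergence of a mixture.  They follow
from total mass one, since the product of two likelihood ratios is a multiple of
the likelihood ratio at the sum of the parameters. *)
Lemma integral_lrM theta theta' : (\int[P]_w (lr theta w * lr theta' w)%:E =
  (expR (n%:R * \sum_i theta i * theta' i))%:E)%E.
Proof.
under eq_integral do rewrite lrM EFinM.
have mlr : measurable_fun [set: T] (fun w => (lr (theta \+ theta') w)%:E).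
  by apply/measurable_EFinP; exact: lr_measurable.
rewrite ge0_integralZl ?lee_fin ?expR_ge0//; first by rewrite integral_lr mule1.
by move=> w _; rewrite lee_fin lr_ge0.
Qed.

(** For two parameters that differ by the sign of one coordinate, the likelihood
ratio test decides by the sign of that observation; it minimizes the sum of the
two error probabilities because the likelihood that counts as its error at a point
is the smaller of the two. *)
Lemma neyman_pearson i theta theta' (A : set (data R J)) :
  measurable A -> (forall k, k != i -> theta k = theta' k) ->
  theta' i <= 0 -> theta i = - theta' i ->
  (Pr_ n z theta [set y : data R J | (y i < 0)%R] +
   Pr_ n z theta' [set y : data R J | (0 <= y i)%R]  <=
   Pr_ n z theta A + Pr_ n z theta' (~` A))%E.
Proof.
move=> mA thetaE theta'0 thetaiE.
pose B : set (data R J) := [set y | y i < 0].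
have mB : measurable B.
  have -> : B = (fun y : data R J => y i) @^-1` `]-oo, 0[%classic.
    by apply/seteqP; split=> y; rewrite /B/= in_itv.
  exact: coordinate_measurable.
have -> : [set y : data R J | 0 <= y i] = ~` B.
  by apply/seteqP; split=> y; rewrite /B/= leNgt => /negP.
rewrite !Pr_lr//; [|exact: measurableC|exact: measurableC].
have mlr t (D : set T) : measurable_fun D (fun w => (lr t w)%:E).
  by apply/measurable_funTS/measurable_EFinP; exact: lr_measurable.
have mo (D : set (data R J)) : measurable D -> measurable (obs (fun=> 0) @^-1` D).
  exact: observation_preimage_measurable.
have mr t (D : set (data R J)) : measurable D -> measurable_fun [set: T]
    ((fun w => (lr t w)%:E) \_ (obs (fun=> 0) @^-1` D)).
  by move=> mD; apply/(measurable_restrictT _ (mo _ mD)).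
have r0 t (D : set T) w : (0 <= ((fun w => (lr t w)%:E) \_ D) w)%E.
  by apply: erestrict_ge0 => x _; rewrite lee_fin lr_ge0.
have mAC := measurableC mA; have mBC := measurableC mB.
rewrite !(integral_mkcond (_ @^-1` _)) -!ge0_integralD//; try exact: mr.
apply: ge0_le_integral => //.
- by move=> w _; apply: adde_ge0.
- by apply: emeasurable_funD; exact: mr.
- by apply: emeasurable_funD; exact: mr.
move=> w _.
have preimC (D : set (data R J)) :
    obs (fun=> 0) @^-1` (~` D) = ~` (obs (fun=> 0) @^-1` D) by [].
rewrite (preimC A) (preimC B) !patchE !in_setC.
have u0 : 0 <= Num.sqrt n%:R :> R by exact: sqrtr_ge0.
have lr_le t t' : (forall k, k != i -> t k = t' k) -> t i = - t' i ->
    t i * z i w <= 0 -> lr t w <= lr t' w.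
  move=> tE tiE tz; rewrite /lr (bigD1 i)//= [leRHS](bigD1 i)//=.
  have -> : \prod_(k | k != i) expR (Num.sqrt n%:R * t k * z k w -
        (Num.sqrt n%:R * t k) ^+ 2 / 2) =
      \prod_(k | k != i) expR (Num.sqrt n%:R * t' k * z k w -
        (Num.sqrt n%:R * t' k) ^+ 2 / 2).
    by apply: eq_bigr => k /tE ->.
  rewrite ler_wpM2r ?prodr_ge0//.
  rewrite ler_expR; have := mulr_ge0_le0 u0 tz; rewrite tiE; lra.
have -> : (w \in obs (fun=> 0) @^-1` B) = (z i w < 0).
  rewrite -[RHS](@pmulr_rlt0 _ (1 / Num.sqrt n%:R)) ?divr_gt0 ?sqrtr_gt0 ?ltr0n//.
  by apply/idP/idP; rewrite in_setE /B/= /observation add0r.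
have [zw|zw] := ltP (z i w) 0; case: ifPn => _; rewrite ?adde0 ?add0e lee_fin//.
- by apply: lr_le => //; rewrite thetaiE mulNr oppr_le0 mulr_le0// ltW.
- apply: lr_le; last by rewrite mulr_le0_ge0.
    by move=> k ki; rewrite thetaE.
  by rewrite thetaiE opprK.
Qed.

End likelihood_ratio_consequences.

(** * Gaussian tails and quantiles *)

Section gauss_tails.
Context (R : realType).
Local Notation gauss := (@normal_prob R 0 1).

Lemma normal_prob_gt (x : R) : gauss `]x, +oo[%classic = (1 - Phi x)%:E.
Proof.
rewrite EFinB /Phi fineK ?fin_num_measure//.
have -> : `]x, +oo[%classic = ~` `]-oo, x]%classic :> set R by rewrite setCitvl.
exact: (@probability_setC _ _ _ (normal_prob (0 : R) 1)).
Qed.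

Lemma normal_prob_ltN (x : R) : gauss `]-oo, - x[%classic = (1 - Phi x)%:E.
Proof.
rewrite -normal_prob_gt.
have indE (A : set R) : measurable A -> gauss A = (\int[gauss]_y (\1_A y)%:E)%E.
  by move=> mA; rewrite integral_indic// setIT.
have mind : measurable_fun [set: R] (fun y : R => (\1_`]-oo, (- x)[%classic y : R)%:E).
  by apply/measurable_EFinP; exact: measurable_indic.
rewrite !indE// -ge0_integral_gauss_opp//.
apply: eq_integral => y _; rewrite !indicE; congr (nat_of_bool _)%:R%:E.
by apply/idP/idP; rewrite !in_setE/= !in_itv/= ?andbT; lra.
Qed.

(** The second case covers levels outside the range of [Phi], for which the first
lower bound is trivial; the dichotomy replaces the surjectivity of [Phi] onto the open unit
interval. *)
Lemma z_quantileP (p : R) : Phi (z_quantile p) = 1 - p \/ z_quantile p = 0.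
Proof.
rewrite /z_quantile.
have [xp|np] := pselect ([set Phi x | x in [set: R]] (1 - p)).
  by left; apply: pinvK; rewrite inE.
right; rewrite /pinv_ splitV /= oinv_surj.
by case: pselect.
Qed.

Lemma Phi_gt_half (x : R) : 1 / 2 < Phi x -> 0 <= x.
Proof.
move=> Phix; rewrite leNgt; apply/negP => x0.
have : (gauss (`]-oo, x]%classic)%R <= gauss (`]-oo, - x[%classic)%R)%E.
  apply: le_measure; rewrite ?inE//.
  by move=> y /=; rewrite !in_itv/=; lra.
rewrite normal_prob_ltN -[leLHS]fineK ?fin_num_measure// lee_fin -/(Phi x); lra.
Qed.

End gauss_tails.

(** * Parameters supported on one level *)

Section sparse.
Context (R : realType) (J : nat).

Definition embed (j : 'I_J) (t : 'I_(2 ^ j) -> R) : besov_index J -> R :=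
  fun i => untag 0 t i.

Lemma level_embed (j : 'I_J) (t : 'I_(2 ^ j) -> R) : level j (embed t) = t.
Proof.
apply/funext => k; rewrite /level /embed.
by rewrite (untagE _ _ (erefl : tag (Tagged (fun j : 'I_J => 'I_(2 ^ j)) k) = j)).
Qed.

Lemma level_embed_neq (j j' : 'I_J) (t : 'I_(2 ^ j) -> R) :
  j' != j -> level j' (embed t) = fun=> 0.
Proof. by move=> jj'; apply/funext => k; rewrite /level /embed untag_dflt. Qed.

Lemma embed0 (j : 'I_J) : embed (j := j) (fun=> 0) = fun=> 0.
Proof. by apply/funext => i; rewrite /embed untag_cst. Qed.

Lemma embed_Tagged (j : 'I_J) (t : 'I_(2 ^ j) -> R) (k : 'I_(2 ^ j)) :
  embed t (Tagged (fun j : 'I_J => 'I_(2 ^ j)) k) = t k.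
Proof. by have /(congr1 (@^~ k)) := level_embed t. Qed.

Lemma sum_embedM (j : 'I_J) (t t' : 'I_(2 ^ j) -> R) :
  \sum_i embed t i * embed t' i = \sum_k t k * t' k.
Proof.
pose F (j' : 'I_J) (k : 'I_(2 ^ j')) :=
  level j' (embed t) k * level j' (embed t') k.
transitivity (\sum_j' \sum_k F j' k).
  by rewrite sig_big_dep/=; apply: eq_bigr => -[].
rewrite (bigD1 j)//= [X in _ + X]big1 ?addr0; last first.
  by move=> j' jj'; rewrite big1// => k _; rewrite /F level_embed_neq ?mul0r.
by apply: eq_bigr => k _; rewrite /F !level_embed.
Qed.

(** The left side of the last hypothesis is the Besov norm of [embed t]. *)
Lemma besov_body_embed (beta p q M a : R) (j : 'I_J) (t : 'I_(2 ^ j) -> R) :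
  0 < p -> 0 < q -> 0 <= a -> (forall k, `|t k| = a) ->
  2 `^ (j%:R * (beta + 1 / 2)) * a <= M -> besov_body beta p q M (embed t).
Proof.
move=> p0 q0 a0 ta aM; rewrite /besov_body/=.
set s := beta + 1 / 2 - 1 / p.
rewrite (bigD1 j)//= [X in _ + X]big1 ?addr0; last first.
  move=> j' jj'; rewrite big1 ?powR0 ?mulr0 ?powR0//; try by rewrite ?div1r ?invr_eq0 gt_eqF.
  move=> k _; rewrite level_embed_neq// normr0 powR0// gt_eqF//.
rewrite !div1r -powRrM mulfV ?gt_eqF// powRr1; last by rewrite mulr_ge0 ?powR_ge0.
rewrite level_embed (eq_bigr (fun=> a `^ p)) => [|k _]; last by rewrite ta.
rewrite sumr_const card_ord -[_ *+ (2 ^ j)%N]mulr_natl powRM ?powR_ge0//.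
rewrite -(powRrM a) mulfV ?gt_eqF// powRr1//.
rewrite natrX -powR_mulrn// -powRrM mulrA -powRD ?pnatr_eq0 ?implybT//.
rewrite (_ : _ + _ = j%:R * (beta + 1 / 2))//.
by rewrite /s; field; rewrite gt_eqF.
Qed.

End sparse.

(** * Probabilities and expectations under a parameter *)

Section confidence_ball_tools.
Context d (T : measurableType d) (R : realType) (P : probability T R).
Context (J n : nat) (z : besov_index J -> {RV P >-> R}).
Implicit Types theta : besov_index J -> R.

(** Real-valued, for arithmetic with sums and differences of probabilities. *)
Definition pr theta (A : set (data R J)) : R := fine (Pr_ n z theta A).

Lemma Pr_pr theta A : measurable A -> Pr_ n z theta A = (pr theta A)%:E.
Proof.
move=> mA; rewrite /pr fineK// /Pr_ /pushforward fin_num_measure//.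
exact: observation_preimage_measurable.
Qed.

Lemma pr_le1 theta A : measurable A -> pr theta A <= 1.
Proof.
move=> mA; rewrite -lee_fin -Pr_pr// /Pr_ /pushforward probability_le1//.
exact: observation_preimage_measurable.
Qed.

Lemma pr_le theta A B : measurable A -> measurable B -> A `<=` B ->
  pr theta A <= pr theta B.
Proof.
move=> mA mB AB; rewrite -lee_fin -!Pr_pr// /Pr_ /pushforward le_measure//;
  by rewrite ?inE; try exact: observation_preimage_measurable; move=> w; exact: AB.
Qed.

Lemma pr_setI_ge theta A B : measurable A -> measurable B ->
  pr theta A + pr theta B - 1 <= pr theta (A `&` B).
Proof.
move=> mA mB; have mAB := measurableI _ _ mA mB; have mU := measurableU _ _ mA mB.
have mo D : measurable D -> measurable (observation n z theta @^-1` D).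
  exact: observation_preimage_measurable.
have : (Pr_ n z theta (A `|` B) =
        Pr_ n z theta A + Pr_ n z theta B - Pr_ n z theta (A `&` B))%E.
  have Bfin : (P (observation n z theta @^-1` B) < +oo)%E.
    by rewrite (le_lt_trans (probability_le1 P (mo _ mB)))// ltry.
  exact: measureUfinr (mo _ mA) (mo _ mB) Bfin.
rewrite !Pr_pr// => -[E]; have := pr_le1 theta mU; rewrite E; lra.
Qed.

Lemma Ex_ge_sum (K : finType) (A : K -> set (data R J)) (b : R)
    (f : data R J -> R) theta :
  (forall k, measurable (A k)) -> 0 <= b ->
  measurable_fun [set: data R J] f ->
  (forall y, \sum_k b * \1_(A k) y <= f y) ->
  ((b * \sum_k pr theta (A k))%:E <= Ex_ n z theta f)%E.
Proof.
move=> mA b0 mf Af; have -> : Ex_ n z theta f = (\int[P]_w (f (observation n z theta w))%:E)%E.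
  by rewrite /Ex_ unlock.
rewrite mulr_sumr -sumEFin.
have mo D : measurable D -> measurable (observation n z theta @^-1` D).
  exact: observation_preimage_measurable.
have mobs := observation_measurable n z theta.
have mI k : measurable_fun [set: T]
    (fun w => (b * \1_(observation n z theta @^-1` A k) w)%:E).
  apply/measurable_EFinP; apply: measurable_funM => //.
  by apply: measurable_indic; exact: mo.
have I0 k w : (0 <= (b * \1_(observation n z theta @^-1` A k) w)%:E)%E.
  by rewrite lee_fin mulr_ge0.
have mf' : measurable_fun [set: T] (fun w => (f (observation n z theta w))%:E).
  by apply/measurable_EFinP; exact: (measurableT_comp mf mobs).
rewrite (eq_bigr (fun k =>
    \int[P]_w (b * \1_(observation n z theta @^-1` A k) w)%:E)%E); last first.
  move=> k _; have mAk := mo _ (mA k).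
  have mind : measurable_fun [set: T]
      (fun w => (\1_(observation n z theta @^-1` A k) w : R)%:E).
    by apply/measurable_EFinP; exact: measurable_indic.
  under eq_integral do rewrite EFinM.
  rewrite ge0_integralZl//.
  by rewrite integral_indic// setIT EFinM -Pr_pr.
rewrite -ge0_integral_sum//; apply: ge0_le_integral => //.
- by move=> w _; apply: sume_ge0.
- by apply: emeasurable_sum.
by move=> w _; rewrite sumEFin lee_fin; exact: Af.
Qed.

(** The ball condition is split into [0 <= r y] and an inequality of squares, which
avoids the square root. *)
Lemma conf_ball_measurable m (delta : data R J -> 'I_m -> R) (r : data R J -> R) t :
  (forall k, measurable_fun [set: data R J] (fun y => delta y k)) ->
  measurable_fun [set: data R J] r ->
  measurable [set y | conf_ball (delta y) (r y) t].
Proof.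
move=> mdelta mr.
have -> : [set y | conf_ball (delta y) (r y) t] =
    ([set: data R J] `&` [set y | 0 <= r y]) `&`
    ([set: data R J] `&` [set y | \sum_k (t k - delta y k) ^+ 2 <= r y ^+ 2]).
  apply/seteqP; split=> y; rewrite /conf_ball/= /l2norm.
    move=> ry; have r0 := le_trans (sqrtr_ge0 _) ry; split; split => //.
    rewrite -(@ler_sqrt _ _ (r y ^+ 2)) ?sqr_ge0// sqrtr_sqr ger0_norm//.
  by move=> [[_ r0] [_ ry]]; rewrite -(ger0_norm r0) -sqrtr_sqr ler_wsqrtr.
have mS : measurable_fun [set: data R J] (fun y => \sum_k (t k - delta y k) ^+ 2).
  apply: measurable_sum => k; apply: measurable_funX.
  by apply: measurable_funB.
have mr2 : measurable_fun [set: data R J] (fun y => r y ^+ 2) by exact: measurable_funX.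
by apply: measurableI; apply: measurable_fun_le.
Qed.

Lemma conf_ball_sum_le m (delta : 'I_m -> R) (r : R) t :
  conf_ball delta r t -> \sum_k (t k - delta k) ^+ 2 <= r ^+ 2.
Proof.
rewrite /conf_ball/= /l2norm => tr; have r0 := le_trans (sqrtr_ge0 _) tr.
rewrite -[leLHS]sqr_sqrtr ?sumr_ge0// => [|k _]; last exact: sqr_ge0.
by rewrite ler_sqr ?nnegrE ?sqrtr_ge0.
Qed.

End confidence_ball_tools.

(** * Sign vectors *)

Section signs.
Context (R : realType).

Definition sign_vec m (a : R) (s : {ffun 'I_m -> bool}) (k : 'I_m) : R := a * (-1) ^+ s k.

Lemma norm_sign_vec m (a : R) (s : {ffun 'I_m -> bool}) k : 0 <= a ->
  `|sign_vec a s k| = a.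
Proof. by move=> a0; rewrite normrM normrX normrN1 expr1n mulr1 ger0_norm. Qed.

Lemma card_signs m : #|{: {ffun 'I_m -> bool}}| = (2 ^ m)%N.
Proof. by rewrite card_ffun card_bool card_ord. Qed.

(** Up to the factor [2 ^ m] this is the expectation of
[expR (c * a ^ 2 * S)] for a sum [S] of [m] independent fair signs; it is the same
for every [s]. *)
Lemma sum_signs_expR m (c a : R) (s : {ffun 'I_m -> bool}) :
  \sum_(s' : {ffun 'I_m -> bool}) expR (c * \sum_k sign_vec a s k * sign_vec a s' k) =
  (expR (c * a ^+ 2) + expR (- (c * a ^+ 2))) ^+ m.
Proof.
under eq_bigr do rewrite mulr_sumr expR_sum.
rewrite -(bigA_distr_bigA (fun k (b : bool) =>
  expR (c * (sign_vec a s k * (a * (-1) ^+ b)))))/=.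
rewrite (eq_bigr (fun=> expR (c * a ^+ 2) + expR (- (c * a ^+ 2)))).
  by rewrite prodr_const card_ord.
move=> k _; rewrite big_bool/= /sign_vec; case: (s k); rewrite ?expr1 ?expr0.
  by congr (expR _ + expR _); ring.
by rewrite addrC; congr (expR _ + expR _); ring.
Qed.

(** From [expR x <= (1 - x)^-1] one gets [cosh x <= (1 - x ^ 2)^-1], which is at most
[1 + 2 x ^ 2] in this range.  The factor [2] in the exponent squares [1 + eps ^ 2]
in the chi-square bound, and [(1 + eps ^ 2) ^ 2 <= 1 + (2 eps) ^ 2]. *)
Lemma cosh_le (x : R) : 0 <= x -> x <= 1 / 2 ->
  (expR x + expR (- x)) / 2 <= expR (2 * x ^+ 2).
Proof.
move=> x0 x1.
have h1 : expR x * (1 - x) <= 1.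
  rewrite -[leRHS](expRxMexpNx_1 x) ler_wpM2l ?expR_ge0//; exact: expR_ge1Dx.
have h2 : expR (- x) * (1 + x) <= 1.
  rewrite -[leRHS](expRxMexpNx_1 x) mulrC ler_wpM2r ?expR_ge0//; exact: expR_ge1Dx.
apply: le_trans (expR_ge1Dx _).
have y1 : x ^+ 2 <= 1 / 4 by nra.
have -> : expR x + expR (- x) = ((expR x * (1 - x)) * (1 + x) +
    (expR (- x) * (1 + x)) * (1 - x)) / (1 - x ^+ 2).
  field; nra.
rewrite ler_pdivrMr// ler_pdivrMr; last by nra.
nra.
Qed.

End signs.

(** * The sign prior *)

Section sign_prior.
Context d (T : measurableType d) (R : realType) (P : probability T R).
Context (J n : nat) (z : besov_index J -> {RV P >-> R}) (j : 'I_J).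
Hypotheses (hn : (0 < n)%N) (hz : iid_std_normal z).

Local Notation signs := {ffun 'I_(2 ^ j) -> bool}.
Local Notation theta a s := (embed (sign_vec a s)).
Local Notation pr := (pr n z).

(** The left side of the last hypothesis is the second moment of the density of the
prior mixture with respect to [P_0]: an average of [integral_lrM] over pairs of
sign vectors.  The conclusion is therefore a total variation bound. *)
Lemma sum_pr_signs_le (a c : R) (A : set (data R J)) : 0 < c -> measurable A ->
  ((expR (n%:R * a ^+ 2) + expR (- (n%:R * a ^+ 2))) / 2) ^+ (2 ^ j) <= 1 + c ^+ 2 ->
  \sum_(s : signs) pr (theta a s) A <= #|{: signs}|%:R * (pr (fun=> 0) A + c).
Proof.
move=> c0 mA chi2.
set N : R := #|{: signs}|%:R.
have N0 : 0 < N by rewrite ltr0n card_signs expn_gt0.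
have NI0 : (0 <= N^-1%:E)%E by rewrite lee_fin invr_ge0 ltW.
pose L w := N^-1 * \sum_(s : signs) lr n z (theta a s) w.
have L0 w : 0 <= L w.
  by rewrite mulr_ge0 ?invr_ge0 ?(ltW N0)// sumr_ge0// => s _; exact: lr_ge0.
have mlr t (D : set T) : measurable_fun D (fun w => (lr n z t w)%:E).
  by apply/measurable_funTS/measurable_EFinP; exact: lr_measurable.
have lr0 t w : (0 <= (lr n z t w)%:E)%E by rewrite lee_fin lr_ge0.
have mL : measurable_fun [set: T] L.
  apply: measurable_funM => //; apply: measurable_sum => s; exact: lr_measurable.
have intL (D : set T) : measurable D -> (\int[P]_(w in D) (L w)%:E =
    N^-1%:E * \sum_(s : signs) \int[P]_(w in D) (lr n z (theta a s) w)%:E)%E.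
  move=> mD; rewrite -ge0_integral_sum//.
  rewrite -ge0_integralZl//; last 2 first.
  - by apply: emeasurable_sum.
  - by move=> w _; apply: sume_ge0.
  by apply: eq_integral => w _; rewrite sumEFin -EFinM.
pose E := observation n z (fun=> 0) @^-1` A.
have mE : measurable E by exact: observation_preimage_measurable.
have LE : (\int[P]_(w in E) (L w)%:E = (N^-1 * \sum_(s : signs) pr (theta a s) A)%:E)%E.
  rewrite intL// EFinM -sumEFin; congr (_ * _)%E; apply: eq_bigr => s _.
  by rewrite -Pr_pr// Pr_lr.
have L1 : (\int[P]_w (L w)%:E = 1)%E.
  rewrite intL// (eq_bigr (fun=> 1%:E)) => [|s _]; last exact: integral_lr.
  by rewrite sumEFin sumr_const -EFinM mulVf// gt_eqF.
have L2 : (\int[P]_w (L w ^+ 2)%:E <= (1 + c ^+ 2)%:E)%E.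
  have mlr2 t t' : measurable_fun [set: T] (fun w => (lr n z t w * lr n z t' w)%:E).
    by apply/measurable_EFinP; apply: measurable_funM; exact: lr_measurable.
  have lr20 t t' w : (0 <= (lr n z t w * lr n z t' w)%:E)%E.
    by rewrite lee_fin mulr_ge0// lr_ge0.
  have -> : (\int[P]_w (L w ^+ 2)%:E = (N ^- 2)%:E * \sum_(s : signs) \sum_(s' : signs)
      \int[P]_w (lr n z (theta a s) w * lr n z (theta a s') w)%:E)%E.
    pose LL (s : signs) w := (\sum_(s' : signs) (lr n z (theta a s) w * lr n z (theta a s') w)%:E)%E.
    have mLL s : measurable_fun [set: T] (LL s) by apply: emeasurable_sum.
    have LL0 s w : (0 <= LL s w)%E by apply: sume_ge0.
    have mSLL : measurable_fun [set: T] (fun w => \sum_(s : signs) LL s w)%E.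
      exact: emeasurable_sum.
    have SLL0 w : (0 <= \sum_(s : signs) LL s w)%E by apply: sume_ge0.
    have N20 : (0 <= (N ^- 2)%:E)%E by rewrite lee_fin invr_ge0 exprn_ge0// ltW.
    rewrite (eq_bigr (fun s => \int[P]_w LL s w)%E); last first.
      by move=> s _; rewrite -ge0_integral_sum.
    rewrite -ge0_integral_sum//.
    rewrite -ge0_integralZl//.
    apply: eq_integral => w _; rewrite /LL.
    under eq_bigr do rewrite sumEFin.
    rewrite sumEFin -EFinM; congr EFin.
    by rewrite /L exprMn exprVn; congr (_ * _); rewrite expr2 big_distrlr.
  under eq_bigr do under eq_bigr do rewrite integral_lrM// sum_embedM.
  under eq_bigr do rewrite sumEFin sum_signs_expR.
  rewrite sumEFin sumr_const -EFinM lee_fin; apply: le_trans chi2.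
  rewrite -[_ *+ #|_|]mulr_natl -/N expr2 invfM mulrA mulfVK ?gt_eqF//.
  by rewrite exprMn exprVn /N card_signs natrX mulrC.
have := integral_le_probability_add c0 L0 mL mE L1 L2.
have -> : P E = Pr_ n z (fun=> 0) A by [].
rewrite LE Pr_pr// -EFinD lee_fin => H.
by rewrite -ler_pdivrMl.
Qed.

Definition flip m (k : 'I_m) (s : {ffun 'I_m -> bool}) : {ffun 'I_m -> bool} :=
  [ffun l => if l == k then ~~ s l else s l].

Lemma flipK m (k : 'I_m) : involutive (flip k).
Proof.
by move=> s; apply/ffunP => l; rewrite !ffunE; case: eqP => // _; rewrite negbK.
Qed.

Lemma embed_eq_off (k : 'I_(2 ^ j)) (t t' : 'I_(2 ^ j) -> R) :
  (forall l, l != k -> t l = t' l) ->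
  forall i : besov_index J, i != Tagged (fun j : 'I_J => 'I_(2 ^ j)) k ->
  embed t i = embed t' i.
Proof.
move=> tt' [j' k'] ik; have [jj'|jj'] := eqVneq j' j; last first.
  have h (u : 'I_(2 ^ j) -> R) : embed u (existT _ j' k') = 0.
    by have /(congr1 (@^~ k')) := level_embed_neq u jj'.
  by rewrite !h.
subst j'; rewrite !embed_Tagged; apply: tt'.
by apply: contraNneq ik => ->.
Qed.

(** [A] is the event that an estimator declares coordinate [k] to be negative; [x]
plays the role of the Gaussian quantile. *)
Lemma sign_error_ge (a x : R) (k : 'I_(2 ^ j)) (s : signs) (A : set (data R J)) :
  measurable A -> 0 <= a -> Num.sqrt n%:R * a <= x -> s k = false ->
  2 * (1 - Phi x) <= pr (theta a s) A + pr (theta a (flip k s)) (~` A).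
Proof.
move=> mA a0 ax sk; set i := Tagged (fun j : 'I_J => 'I_(2 ^ j)) k.
have u0 : 0 < Num.sqrt n%:R :> R by rewrite sqrtr_gt0 ltr0n.
have ti : embed (sign_vec a s) i = a.
  by rewrite /i embed_Tagged /sign_vec sk expr0 mulr1.
have t'i : embed (sign_vec a (flip k s)) i = - a.
  by rewrite /i embed_Tagged /sign_vec ffunE eqxx sk expr1 mulrN1.
have obsE w : observation n z (embed (sign_vec a s)) w i = a + 1 / Num.sqrt n%:R * z i w.
  by rewrite /observation ti.
have obs'E w : observation n z (embed (sign_vec a (flip k s))) w i =
    - a + 1 / Num.sqrt n%:R * z i w.
  by rewrite /observation t'i.
have mAC := measurableC mA.
have zlaw (B : set R) : measurable B -> P (z i @^-1` B) = normal_prob 0 1 B.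
  by move=> mB; exact: (hz.1 i).
have := neyman_pearson hn hz (i := i) (theta := embed (sign_vec a s))
  (theta' := embed (sign_vec a (flip k s))) mA.
rewrite ti t'i opprK oppr_le0 => /(_ _ a0 erefl).
move=> NP; rewrite -lee_fin.
pose B : set (data R J) := [set y | y i < 0].
have mB : measurable B.
  have -> : B = (fun y : data R J => y i) @^-1` `]-oo, 0[%classic.
    by apply/seteqP; split=> y; rewrite /B/= in_itv.
  exact: coordinate_measurable.
have BC : [set y : data R J | 0 <= y i] = ~` B.
  by apply/seteqP; split=> y; rewrite /B/= leNgt => /negP.
have mBC := measurableC mB.
have {}NP : ((pr (theta a s) A + pr (theta a (flip k s)) (~` A))%:E >=
    Pr_ n z (theta a s) B + Pr_ n z (theta a (flip k s)) (~` B))%E.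
  rewrite EFinD -!Pr_pr// -BC; apply: NP.
  by apply: embed_eq_off => l lk; rewrite /sign_vec ffunE (negbTE lk).
apply: le_trans NP.
have -> : 2 * (1 - Phi x) = (1 - Phi x) + (1 - Phi x) by ring.
rewrite EFinD; apply: leeD.
  rewrite -normal_prob_ltN -zlaw//.
  apply: le_measure; rewrite ?inE.
  - by rewrite -[X in measurable X]setTI; exact: measurable_funP.
  - exact: observation_preimage_measurable.
  move=> w /=; rewrite in_itv/= /B => zx; rewrite /preimage/= obsE.
  rewrite -(pmulr_rlt0 _ u0) mulrDr mulrA mulrCA divff ?gt_eqF// mulr1; lra.
rewrite -normal_prob_gt -zlaw//.
apply: le_measure; rewrite ?inE.
- by rewrite -[X in measurable X]setTI; exact: measurable_funP.
- exact: observation_preimage_measurable.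
rewrite -BC => w /=; rewrite in_itv/= andbT => zx; rewrite obs'E.
rewrite -(pmulr_rge0 _ u0) mulrDr mulrA mulrCA divff ?gt_eqF// mulr1; lra.
Qed.

End sign_prior.

(** * The prior lies in the Besov body *)

Section least_favorable_amplitude.
Context (R : realType) (J : nat) (j : 'I_J) (beta p q M b : R).
Hypotheses (hp : 2 <= p) (hq : 1 <= q) (hM : 0 < M).
Hypotheses (b0 : 0 <= b) (bM : b <= M ^+ 2 * 2 `^ (- (2 * beta * j%:R))).

(** The common absolute value of the [2 ^ j] entries of a vector of squared norm
[b]. *)
Definition amplitude : R := Num.sqrt (b / 2 ^+ j).

Lemma amplitude_ge0 : 0 <= amplitude. Proof. exact: sqrtr_ge0. Qed.

Lemma amplitude_sqr : amplitude ^+ 2 = b / 2 ^+ j.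
Proof. by rewrite sqr_sqrtr// divr_ge0// exprn_ge0. Qed.

Lemma besov_body_signs (s : {ffun 'I_(2 ^ j) -> bool}) :
  besov_body beta p q M (embed (sign_vec amplitude s)).
Proof.
have a0 := amplitude_ge0.
have p0 : 0 < p := lt_le_trans (ltr0Sn _ 1) hp.
have q0 : 0 < q := lt_le_trans ltr01 hq.
apply: (besov_body_embed p0 q0 a0) => [k|]; first exact: norm_sign_vec.
rewrite -ler_sqr ?nnegrE ?mulr_ge0 ?powR_ge0 ?(ltW hM)// exprMn amplitude_sqr.
have -> : (2 `^ (j%:R * (beta + 1 / 2))) ^+ 2 = 2 `^ (2 * beta * j%:R) * 2 ^+ j :> R.
  rewrite -powR_mulrn ?powR_ge0// -powRrM -(@powR_mulrn R 2 j)// -powRD.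
    by congr (_ `^ _); field.
  by rewrite pnatr_eq0 implybT.
have m0 : 0 < (2 : R) ^+ j by rewrite exprn_gt0.
set e := 2 * beta * j%:R; rewrite [_ * (b / _)]mulrCA mulfK ?gt_eqF//.
by rewrite -ler_pdivlMr ?powR_gt0// -powRN.
Qed.

Lemma besov_body0 : @besov_body R J beta p q M (fun _ : besov_index J => 0).
Proof.
have p0 : 0 < p := lt_le_trans (ltr0Sn _ 1) hp.
have q0 : 0 < q := lt_le_trans ltr01 hq.
rewrite -(embed0 R j); apply: (besov_body_embed p0 q0 (lexx 0)) => [k|].
  by rewrite normr0.
by rewrite mulr0 ltW.
Qed.

End least_favorable_amplitude.

(** * Lower bounds for the radius *)

Section lower_bounds.
Context d (T : measurableType d) (R : realType) (P : probability T R).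
Context (J n : nat) (hn : (0 < n)%N) (z : besov_index J -> {RV P >-> R})
  (hz : iid_std_normal z).
Context (j : 'I_J) (delta : data R J -> 'I_(2 ^ j) -> R) (r : data R J -> R).
Hypotheses (hdelta : forall k, measurable_fun [set: data R J] (fun y => delta y k))
  (hr : measurable_fun [set: data R J] r).
Context (alpha a : R).
Hypothesis a0 : 0 <= a.

Local Notation signs := {ffun 'I_(2 ^ j) -> bool}.
Local Notation theta s := (embed (sign_vec a s)).
Local Notation pr := (pr n z).
Local Notation covers t := [set y | conf_ball (delta y) (r y) t].

Hypothesis cov : forall s : signs,
  1 - alpha <= pr (theta s) (covers (sign_vec a s)).

Let mcov t : measurable (covers t).
Proof. exact: conf_ball_measurable. Qed.

(** With probability at least [1 - 2 alpha - c] under [P_0], the ball contains two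
points at distance [2 ^ (j / 2) * a], namely [0] and some sign vector, so that its
diameter is at least that distance. *)
Lemma chi2_lower_bound (c : R) : 0 < c ->
  1 - alpha <= pr (fun=> 0) (covers (fun=> 0)) ->
  ((expR (n%:R * a ^+ 2) + expR (- (n%:R * a ^+ 2))) / 2) ^+ (2 ^ j) <= 1 + c ^+ 2 ->
  (((2 ^+ j * a ^+ 2) / 4 * (1 - 2 * alpha - c))%:E <=
   Ex_ n z (fun=> 0)%R (fun y => r y ^+ 2)%R)%E.
Proof.
move=> c0 cov0 chi2.
pose A := \bigcup_(s in [set: signs]) covers (sign_vec a s).
have mA : measurable A.
  apply: fin_bigcup_measurable; first exact: finite_finset.
  by move=> s _; exact: mcov.
have prA : 1 - alpha - c <= pr (fun=> 0) A.
  have := sum_pr_signs_le hn hz c0 mA chi2.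
  set N : R := #|{: signs}|%:R.
  have N0 : 0 < N by rewrite ltr0n card_signs expn_gt0.
  have : N * (1 - alpha) <= \sum_(s : signs) pr (theta s) A.
    rewrite mulrC mulr_natr -sumr_const; apply: ler_sum => s _.
    apply: le_trans (cov s) _; apply: pr_le => //.
    by move=> y ys; exists s.
  move=> h1 h2; have := le_trans h1 h2; rewrite ler_pM2l//; lra.
have mI := measurableI _ _ mA (mcov (fun=> 0)).
have := @Ex_ge_sum _ _ _ P _ n z unit (fun=> A `&` covers (fun=> 0))
  ((2 ^+ j * a ^+ 2) / 4) (fun y => r y ^+ 2) (fun=> 0).
rewrite big_const card_unit/= addr0 => H; apply: le_trans (H _ _ _ _) => //.
- rewrite lee_fin ler_wpM2l//; first by rewrite divr_ge0// mulr_ge0// ?exprn_ge0// sqr_ge0.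
  have := pr_setI_ge n z (fun=> 0) mA (mcov (fun=> 0)); lra.
- by rewrite divr_ge0// mulr_ge0// ?exprn_ge0// sqr_ge0.
- exact: measurable_funX.
move=> y; rewrite big_const card_unit/= addr0 indicE.
have [/set_mem[[s _ /conf_ball_sum_le ys] /conf_ball_sum_le y0]|_] := boolP (y \in _); last first.
  by rewrite mulr0 sqr_ge0.
rewrite mulr1.
have <- : \sum_k sign_vec a s k ^+ 2 = 2 ^+ j * a ^+ 2.
  rewrite (eq_bigr (fun=> a ^+ 2)); first by rewrite sumr_const card_ord -[LHS]mulr_natl natrX.
  by move=> k _; rewrite -[LHS]real_normK ?num_real// norm_sign_vec.
(* [t ^ 2 <= 2 (t - delta) ^ 2 + 2 delta ^ 2] stands in for the triangle
   inequality and gives the same constant. *)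
suff : \sum_k sign_vec a s k ^+ 2 <= \sum_k (sign_vec a s k - delta y k) ^+ 2 *+ 2 +
   \sum_k (0 - delta y k) ^+ 2 *+ 2 by rewrite !sumrMnl; lra.
rewrite -big_split/=; apply: ler_sum => k _.
have := sqr_ge0 (sign_vec a s k - 2 * delta y k); nra.
Qed.

(** For each coordinate the average probability over the prior of a wrong sign is at
least [alpha + 2 eps], and subtracting the miss probability leaves [2 eps] for a
wrong sign together with coverage. *)
Lemma sign_error_lower_bound (eps x : R) :
  0 < eps -> Num.sqrt n%:R * a <= x -> 1 - Phi x = alpha + 2 * eps ->
  exists s : signs, ((2 * eps * (2 ^+ j * a ^+ 2))%:E <=
    Ex_ n z (theta s) (fun y => r y ^+ 2)%R)%E.
Proof.
move=> eps0 ax Phix.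
(* [W s k]: the sign of [delta y k] disagrees with that of the parameter. *)
pose W (s : signs) k : set (data R J) :=
  if s k then ~` [set y | delta y k < 0] else [set y | delta y k < 0].
have mneg k : measurable [set y : data R J | delta y k < 0].
  have -> : [set y : data R J | delta y k < 0] = (fun y => delta y k) @^-1` `]-oo, 0[%classic.
    by apply/seteqP; split=> y; rewrite /= in_itv.
  by rewrite -[X in measurable X]setTI; apply: hdelta.
have mW s k : measurable (W s k).
  by rewrite /W; case: ifP => _ //; exact: measurableC.
have mWS s k : measurable (covers (sign_vec a s) `&` W s k) by exact: measurableI.
set N : R := #|{: signs}|%:R.
have N0 : 0 < N by rewrite ltr0n card_signs expn_gt0.
have err k : N * (alpha + 2 * eps) <= \sum_(s : signs) pr (theta s) (W s k).
  (* Pair each sign vector with the one obtained by flipping coordinate [k]. *)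
  pose f s := pr (theta s) (W s k).
  have fflip s : 2 * (alpha + 2 * eps) <= f s + f (flip k s).
    rewrite -Phix /f; case sk : (s k); last first.
      have := sign_error_ge hn hz (mneg k) a0 ax sk.
      have fsk : flip k s k = true by rewrite ffunE eqxx sk.
      by rewrite /W sk fsk.
    have fsk : flip k s k = false by rewrite ffunE eqxx sk.
    have := sign_error_ge hn hz (mneg k) a0 ax fsk.
    by rewrite flipK [X in _ -> _ <= X]addrC /W sk fsk.
  have : \sum_(s : signs) 2 * (alpha + 2 * eps) <= \sum_(s : signs) (f s + f (flip k s)).
    by apply: ler_sum => s _.
  rewrite sumr_const -[leLHS]mulr_natl -/N big_split/=.
  have -> : \sum_(s : signs) f (flip k s) = \sum_(s : signs) f s.
    by rewrite [RHS](reindex_inj (inv_inj (flipK k))).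
  by rewrite -[\sum_(s : signs) pr _ _]/(\sum_(s : signs) f s); lra.
pose m : R := 2 ^+ j.
have [s hs] : exists s : signs,
    2 * eps * m <= \sum_k pr (theta s) (covers (sign_vec a s) `&` W s k).
  apply/not_existsP => hlt.
  have : \sum_(s : signs) \sum_k pr (theta s) (covers (sign_vec a s) `&` W s k) <
         \sum_(s : signs) 2 * eps * m.
    apply: ltr_sum; first by apply/hasP; exists [ffun=> true]; rewrite ?mem_index_enum.
    by move=> s _; rewrite ltNge; apply/negP; exact: hlt.
  rewrite sumr_const -[X in _ < X]mulr_natl -/N ltNge => /negP; apply.
  rewrite exchange_big/=.
  have -> : N * (2 * eps * m) = \sum_(k < 2 ^ j) N * (2 * eps).
    by rewrite sumr_const card_ord -[RHS]mulr_natl natrX /m; ring.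
  apply: ler_sum => k _; apply: (@le_trans _ _ (\sum_(s : signs) (pr (theta s) (W s k) - alpha))).
    by rewrite sumrB sumr_const -[X in _ - X]mulr_natl -/N; have := err k; lra.
  apply: ler_sum => s _.
  have := pr_setI_ge n z (theta s) (mcov (sign_vec a s)) (mW s k).
  by have := cov s; lra.
exists s.
have := @Ex_ge_sum _ _ _ P _ n z 'I_(2 ^ j)
  (fun k => covers (sign_vec a s) `&` W s k) (a ^+ 2) (fun y => r y ^+ 2) (theta s).
move=> H; apply: le_trans (H _ _ _ _) => //.
- rewrite lee_fin -/m (_ : _ * (m * _) = a ^+ 2 * (2 * eps * m)); last by ring.
  by rewrite ler_wpM2l// sqr_ge0.
- exact: sqr_ge0.
- exact: measurable_funX.
move=> y; have [cy|ncy] := pselect (covers (sign_vec a s) y); last first.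
  rewrite big1 ?sqr_ge0// => k _; rewrite indicE memNset ?mulr0//.
  by case.
apply: le_trans (conf_ball_sum_le cy); apply: ler_sum => k _.
rewrite indicE; have [/set_mem[_]|_] := boolP (y \in _); last by rewrite mulr0 sqr_ge0.
rewrite mulr1 /W /sign_vec; set u := delta y k; case: (s k) => /=.
  move=> /negP; rewrite -leNgt -/u => u0; rewrite mulrN1.
  by have := mulr_ge0 a0 u0; have := sqr_ge0 u; nra.
rewrite -/u mulr1 => u0.
by have := mulr_ge0_le0 a0 (ltW u0); have := sqr_ge0 u; nra.
Qed.

End lower_bounds.

(** * The theorem *)

Theorem theorem1 (R : realType) (d : measure_display) (T : measurableType d)
    (P : probability T R) (J n : nat) (hn : (0 < n)%N)
    (z : besov_index J -> {RV P >-> R}) (hz : iid_std_normal z)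
    (beta p q M : R) (hbeta : 0 < beta) (hp : 2 <= p) (hq : 1 <= q)
    (hM : 0 < M)
    (alpha : R) (halpha0 : 0 < alpha) (halpha1 : alpha < 1 / 2)
    (j : 'I_J) (delta : data R J -> 'I_(2 ^ j) -> R) (r : data R J -> R)
    (hdelta : forall k, measurable_fun [set: data R J] (fun y => delta y k))
    (hr : measurable_fun [set: data R J] r)
    (hcov : ((1 - alpha)%:E <=
       ereal_inf [set Pr_ n z theta
                        [set y | conf_ball (delta y) (r y) (level j theta)]
                 | theta in besov_body beta p q M])%E) :
  (forall eps : R, 0 < eps -> eps < 1 / 2 * (1 / 2 - alpha) ->
     ((eps ^+ 2 / (1 - alpha - eps) *
       Num.min (M ^+ 2 * 2 `^ (- (2 * beta * j%:R)))
               (z_quantile (alpha + 2 * eps) ^+ 2 * 2 ^+ j / n%:R))%:E <=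
      ereal_sup [set Ex_ n z theta (fun y => r y ^+ 2)%R
                | theta in besov_body beta p q M])%E) /\
  (forall eps : R, 0 < eps -> eps < 1 / 2 - alpha ->
     ((1 / 4 * (1 - 2 * alpha - 2 * eps) *
       Num.min (M ^+ 2 * 2 `^ (- (2 * beta * j%:R)))
               (Num.sqrt (ln (1 + eps ^+ 2)) * 2 `^ (j%:R / 2) / n%:R))%:E <=
      Ex_ n z (fun=> 0)%R (fun y => r y ^+ 2)%R)%E).
Proof.
have mcov t : measurable [set y | conf_ball (delta y) (r y) t].
  exact: conf_ball_measurable.
have covP theta : besov_body beta p q M theta ->
    1 - alpha <= pr n z theta [set y | conf_ball (delta y) (r y) (level j theta)].
  move=> Btheta; rewrite -lee_fin -Pr_pr//; apply: le_trans hcov _.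
  by apply: ereal_inf_lbound; exists theta.
have n0 : 0 < n%:R :> R by rewrite ltr0n.
have m0 : 0 < 2 ^+ j :> R by rewrite exprn_gt0.
pose A : R := M ^+ 2 * 2 `^ (- (2 * beta * j%:R)).
have A0 : 0 <= A by apply: mulr_ge0; rewrite ?sqr_ge0 ?powR_ge0.
have in_body (b : R) : 0 <= b -> b <= A -> forall s : {ffun 'I_(2 ^ j) -> bool},
    besov_body beta p q M (embed (sign_vec (amplitude j b) s)).
  by move=> b0 bA s; exact: besov_body_signs.
have zero_body : @besov_body R J beta p q M (fun=> 0) by exact: besov_body0.
have covs (b : R) : 0 <= b -> b <= A -> forall s : {ffun 'I_(2 ^ j) -> bool},
    1 - alpha <= pr n z (embed (sign_vec (amplitude j b) s))
      [set y | conf_ball (delta y) (r y) (sign_vec (amplitude j b) s)].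
  by move=> b0 bA s; have := covP _ (in_body b b0 bA s); rewrite level_embed.
have amp (b : R) : 0 <= b -> 2 ^+ j * amplitude j b ^+ 2 = b.
  by move=> b0; rewrite amplitude_sqr// mulrCA divff ?gt_eqF// mulr1.
split=> eps eps0 epsa; rewrite -/A.
- set zq := z_quantile _.
  set b := Num.min _ _.
  have zq2 : 0 <= zq ^+ 2 * 2 ^+ j / n%:R.
    by rewrite divr_ge0 ?(ltW n0)// mulr_ge0 ?sqr_ge0 ?(ltW m0).
  have b0 : 0 <= b by rewrite le_min A0.
  have bA : b <= A by rewrite ge_min lexx.
  have bz : b <= zq ^+ 2 * 2 ^+ j / n%:R by rewrite ge_min lexx orbT.
  (* If the quantile is the default value 0, then [b = 0]. *)
  have [Phiz|zq0] := z_quantileP (alpha + 2 * eps); last first.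
    have -> : b = 0.
      by apply/eqP; rewrite eq_le b0 andbT (le_trans bz)// /zq zq0 expr0n !mul0r.
    rewrite mulr0; apply: ereal_sup_ge; exists (Ex_ n z (fun=> 0) (fun y => r y ^+ 2)).
      by exists (fun=> 0).
    by apply: expectation_ge0 => w; exact: sqr_ge0.
  have zq_ge0 : 0 <= zq by apply: Phi_gt_half; rewrite Phiz; lra.
  have ax : Num.sqrt n%:R * amplitude j b <= zq.
    rewrite -ler_sqr ?nnegrE ?mulr_ge0 ?sqrtr_ge0// exprMn sqr_sqrtr ?(ltW n0)//.
    rewrite amplitude_sqr// mulrA ler_pdivrMr// mulrC -ler_pdivlMr//.
  have [|s hs] := sign_error_lower_bound hn hz hdelta hr (amplitude_ge0 j b)
    (covs b b0 bA) eps0 ax.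
    by rewrite Phiz; lra.
  apply: ereal_sup_ge.
  exists (Ex_ n z (embed (sign_vec (amplitude j b) s)) (fun y => r y ^+ 2)).
    by exists (embed (sign_vec (amplitude j b) s)); first exact: in_body.
  apply: le_trans hs; rewrite lee_fin amp// ler_wpM2r// ler_pdivrMr; last by lra.
  by rewrite expr2 -mulrA mulrCA ler_wpM2l ?(ltW eps0)//; lra.
- set b := Num.min _ _.
  set u := ln _ in b *.
  have eps2 : 0 < 1 + eps ^+ 2 by have := sqr_ge0 eps; lra.
  have eps2_le : eps ^+ 2 <= 1 / 4.
    have -> : 1 / 4 = (1 / 2) ^+ 2 :> R by field.
    by rewrite ler_sqr ?nnegrE; lra.
  have eu : expR u = 1 + eps ^+ 2 by rewrite lnK// posrE.
  have u_le : u <= eps ^+ 2 by have := expR_ge1Dx u; rewrite eu; lra.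
  have u0 : 0 <= u by rewrite ln_ge0// lerDl sqr_ge0.
  have b0 : 0 <= b by rewrite le_min A0/= divr_ge0 ?(ltW n0)// mulr_ge0 ?sqrtr_ge0 ?powR_ge0.
  have bA : b <= A by rewrite ge_min lexx.
  have bu : b <= Num.sqrt u * 2 `^ (j%:R / 2) / n%:R by rewrite ge_min lexx orbT.
  pose x := n%:R * amplitude j b ^+ 2.
  have x0 : 0 <= x by apply: mulr_ge0; rewrite ?sqr_ge0 ?(ltW n0).
  (* The second entry of the minimum is chosen for this bound on the exponent of
     the chi-square divergence. *)
  have mx : 2 ^+ j * x ^+ 2 <= u.
    have nb : (n%:R * b) ^+ 2 <= u * 2 ^+ j.
      have -> : u * 2 ^+ j = (Num.sqrt u * 2 `^ (j%:R / 2)) ^+ 2.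
        rewrite exprMn sqr_sqrtr// -(@powR_mulrn _ (2 `^ _)) ?powR_ge0// -powRrM.
        by rewrite divfK ?pnatr_eq0// powR_mulrn.
      rewrite ler_sqr ?nnegrE ?mulr_ge0 ?powR_ge0 ?sqrtr_ge0 ?(ltW n0)//.
      by rewrite mulrC -ler_pdivlMr.
    rewrite /x amplitude_sqr//.
    have -> : 2 ^+ j * (n%:R * (b / 2 ^+ j)) ^+ 2 = (n%:R * b) ^+ 2 / 2 ^+ j.
      by field; rewrite gt_eqF.
    by rewrite ler_pdivrMr.
  (* [cosh_le] applies because [x ^ 2 <= m x ^ 2 <= u <= eps ^ 2]. *)
  have x2 : x ^+ 2 <= 1 / 4.
    apply: (@le_trans _ _ (2 ^+ j * x ^+ 2)).
      by rewrite ler_peMl ?sqr_ge0// exprn_ege1// ler1n.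
    exact: le_trans mx (le_trans u_le eps2_le).
  have x1 : x <= 1 / 2.
    rewrite -ler_sqr ?nnegrE//; apply: le_trans x2 _; lra.
  have chi2 : ((expR x + expR (- x)) / 2) ^+ (2 ^ j) <= 1 + (2 * eps) ^+ 2.
    apply: (@le_trans _ _ (expR (2 * x ^+ 2) ^+ (2 ^ j))).
      by rewrite lerXn2r ?nnegrE ?cosh_le ?divr_ge0 ?addr_ge0 ?expR_ge0.
    rewrite -expRM_natl natrX.
    apply: (@le_trans _ _ (expR (2 * u))); first by rewrite ler_expR; lra.
    rewrite expRM_natl eu.
    have -> : (1 + eps ^+ 2) ^+ 2 = 1 + 2 * eps ^+ 2 + eps ^+ 2 * eps ^+ 2 by ring.
    have : eps ^+ 2 * eps ^+ 2 <= eps ^+ 2 * 1 by rewrite ler_wpM2l ?sqr_ge0//; lra.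
    by rewrite exprMn; lra.
  have eps20 : 0 < 2 * eps by lra.
  have := chi2_lower_bound hn hz hdelta hr (amplitude_ge0 j b)
    (covs b b0 bA) eps20 (covP _ zero_body) chi2.
  apply: le_trans; rewrite lee_fin amp//; lra.
Qed.
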